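(* In the setting described in the context, assume $S=\max_{j\le k}|\mathrm{spt}(\boldsymbol{\theta}_j)|<m/2$. Let $q\in(0,1)$. Suppose the following conditions are satisfied. 1) (Restricted eigenvalue) For some $K>1$, $\kappa:=\kappa_X(2S,K)>0$. 2) (Quadratic lower bound of expected loss) For some $C_\gamma>0$ and all $i\le N$ and $\boldsymbol{u}\in D$, $\mathsf{E}\gamma_i(Z_i\boldsymbol{u},Y_i)-\mathsf{E}\gamma_i(Z_i\boldsymbol{\theta},Y_i)\ge C_\gamma\|Z_i(\boldsymbol{u}-\boldsymbol{\theta})\|_2^2$. 3) (Local Lipschitz) There is $M_q>0$ such that with probability at least $1-q$, $$\Big|\sum_{i\le N}[[\gamma_i(Z_i\boldsymbol{u},Y_i)-\gamma_i(Z_i\boldsymbol{\theta},Y_i)]]\Big|\le M_q\|\boldsymbol{u}-\boldsymbol{\theta}\|_1=M_q\sum_{j\le k}\|\boldsymbol{u}_j-\boldsymbol{\theta}_j\|_1\quad\text{for all }\boldsymbol{u}\in D.$$ Let $$\lambda=\frac{(K+1)M_q}{K-1},\qquad L_N=\frac{2M_qK}{N\kappa^2C_\gamma(K-1)}.$$ Then, using this $\lambda$ in the Lasso estimator $$\widehat{\boldsymbol{\theta}}=\arg\min_{\boldsymbol{u}\in D}\Big\{\sum_{i\le N}\gamma_i(Z_i\boldsymbol{u},Y_i)+\lambda\|\boldsymbol{u}\|_1\Big\},$$ with probability at least $1-q$, $$\|\widehat{\boldsymbol{\theta}}-\boldsymbol{\theta}\|_2^2\le kL_N^2S\Big[2+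K^2+\frac{2(1+K^2)(N\kappa^2+\sigma_{X,S}^2k)}{N\kappa^2}\mathbf{1}\{k>1\}\Big].$$
   Context: Setting. $N,k,m\ge1$ are integers, $V=\mathbb{R}^m$, $p=km$. $Y_1,\ldots,Y_N$ are independent random variables with values in a measurable space $\mathcal{Y}$, and $\gamma_1,\ldots,\gamma_N$ are measurable functions $\mathbb{R}^k\times\mathcal{Y}\to\mathbb{R}$. $X_1,\ldots,X_N\in V$ are fixed covariate vectors and $X$ is the $N\times m$ design matrix with rows $X_1^\top,\ldots,X_N^\top$. Parameters are $\boldsymbol{u}_1,\ldots,\boldsymbol{u}_k\in V$; $\boldsymbol{u}\in\mathbb{R}^p$ denotes their concatenation $(\boldsymbol{u}_1^\top,\ldots,\boldsymbol{u}_k^\top)^\top$, and $Z_i$ is the $k\times p$ block-diagonal matrix with $k$ diagonal blocks all equal to the row vector $X_i^\top$, so that $Z_i\boldsymbol{u}=(X_i^\top\boldsymbol{u}_1,\ldots,X_i^\top\boldsymbol{u}_k)^\top$. $D\subset\mathbb{R}^p$ is a compact domain, $L(\boldsymbol{u})=\sum_{i\le N}\mathsf{E}\gamma_i(Z_i\boldsymbol{u},Y_i)$, and $\boldsymbol{\theta}=(\boldsymbol{\theta}_1,\ldots,\boldsymbol{\theta}_k)=\arg\min_{\boldsymbol{u}\in D}L(\boldsymbol{u})$. The minima defining $\boldsymbol{\theta}$ and $\widehat{\boldsymbol{\theta}}$ are assumed to be attained, but need not be attained uniquely; $x=\arg\min f$ just means $f(x)=\min f$. Notation. For a random variable $\xi$,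 $[[\xi]]=\xi-\mathsf{E}\xi$. $\mathrm{spt}(\boldsymbol{v})=\{h:v_h\ne0\}$. For $J\subset\{1,\ldots,m\}$, $\pi_J\boldsymbol{v}$ has coordinates $v_h\mathbf{1}\{h\in J\}$, and $J^c=\{1,\ldots,m\}\setminus J$. $\|\cdot\|_q$ is the $\ell_q$ norm. For $l\ge1$, $$\sigma_{X,l}=\max\Big\{\frac{\|X\boldsymbol{v}\|_2}{\|\boldsymbol{v}\|_2}:\boldsymbol{v}\in V,\ 1\le|\mathrm{spt}(\boldsymbol{v})|\le l\Big\}.$$ For $s\le m$ and $K>0$, $$\kappa_X(s,K)=\min\Big\{\frac{\|X\boldsymbol{v}\|_2}{\sqrt N\,\|\pi_J\boldsymbol{v}\|_2}:\ \boldsymbol{v}\in\mathbb{R}^m\setminus\{\boldsymbol{0}\},\ \|\pi_{J^c}\boldsymbol{v}\|_1\le K\|\pi_J\boldsymbol{v}\|_1,\ 1\le|J|\le s\Big\}.$$ *)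

(* Defs.v *)
From HB Require Import structures.
From mathcomp Require Import all_boot all_order all_algebra.
From mathcomp Require Import all_classical all_reals all_analysis.

Set Implicit Arguments.
Unset Strict Implicit.
Unset Printing Implicit Defensive.

Import Order.TTheory GRing.Theory Num.Theory.
Import numFieldNormedType.Exports.

Local Open Scope classical_set_scope.
Local Open Scope ring_scope.

Section vectors.
Context {R : realType}.

Definition l1norm {n} (v : 'cV[R]_n) : R := \sum_(h < n) `|v h 0|.

Definition l2norm {n} (v : 'cV[R]_n) : R := Num.sqrt (\sum_(h < n) v h 0 ^+ 2).

Definition spt {n} (v : 'cV[R]_n) : {set 'I_n} := [set h | v h 0 != 0]%SET.

Definition proj {n} (J : {set 'I_n}) (v : 'cV[R]_n) : 'cV[R]_n :=
  \col_h (if h \in J then v h 0 else 0).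

(* [mxvec_index j h] is the index of coordinate [h] of the [j]-th block in the
   concatenation of [k] vectors of length [m]. *)
Definition block {k m} (u : 'cV[R]_(k * m)) (j : 'I_k) : 'cV[R]_m :=
  \col_h u (mxvec_index j h) 0.

Definition max_spt {k m} (u : 'cV[R]_(k * m)) : nat :=
  \max_(j < k) #|spt (block u j)|.

(* Row [a] of the block-diagonal matrix is the concatenation of [k] row vectors
   of length [m], of which the [a]-th is [x] and the others vanish. *)
Definition blockdiag k {m} (x : 'rV[R]_m) : 'M[R]_(k, k * m) :=
  \matrix_(a < k) mxvec (\matrix_(b < k, h < m) (if b == a then x 0 h else 0)).

Lemma blockdiag_mul k m (x : 'rV[R]_m) (u : 'cV[R]_(k * m)) (j : 'I_k) :
  (blockdiag k x *m u) j 0 = (x *m block u j) 0 0.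
Proof.
rewrite !mxE (reindex _ (curry_mxvec_bij k m)) /=.
rewrite (eq_bigr (fun p : 'I_k * 'I_m =>
  (if p.1 == j then x 0 p.2 else 0) * u (mxvec_index p.1 p.2) 0)); last first.
  by case=> b h _ /=; rewrite mxE mxvecE mxE.
rewrite -(pair_bigA _ (fun b h =>
  (if b == j then x 0 h else 0) * u (mxvec_index b h) 0)) /=.
rewrite (bigD1 j) //= [X in _ + X]big1 ?addr0.
  by apply: eq_bigr => h _; rewrite eqxx mxE.
by move=> b /negPf bj; rewrite big1// => h _; rewrite bj mul0r.
Qed.

End vectors.

Section design.
Context {R : realType} {N m : nat}.
Variable X : 'M[R]_(N, m).

(* The supremum is a maximum as soon as [0 < l] and [0 < m]; for [l = 0] the set
   is empty and the value is 0. *)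
Definition sigmaX (l : nat) : R :=
  sup [set r | exists2 v : 'cV[R]_m, (1 <= #|spt v| <= l)%N &
                 r = l2norm (X *m v) / l2norm v].

(* The infimum is a minimum as soon as [0 < s], [0 < m] and [0 < N]; for [s = 0]
   there is no constraint and the value is [+oo], which is why it is taken in
   the extended reals (the real infimum of the empty set is 0). *)
Definition kappaX (s : nat) (K : R) : \bar R :=
  ereal_inf [set r | exists v : 'cV[R]_m, exists J : {set 'I_m},
    [/\ v != 0, l1norm (proj (~: J)%SET v) <= K * l1norm (proj J v),
        (1 <= #|J| <= s)%N &
        r = (l2norm (X *m v) / (Num.sqrt N%:R * l2norm (proj J v)))%:E]].

End design.

Definition is_argmin {R : realType} {U : Type} (D : set U) (f : U -> R) (x : U) :=
  D x /\ forall u, D u -> f x <= f u.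

Section prob.
Context {d} {Omega : measurableType d} {R : realType}.
Variable P : probability Omega R.

Definition expect (f : Omega -> R) : R := fine 'E_P[f].

Definition centered (f : Omega -> R) (w : Omega) : R := f w - expect f.

(* [E] may be defined by uncountably many constraints, or by an arbitrary choice
   of minimizers, and need not be measurable: it is required to contain an event
   of probability at least [a].  For measurable [E] this is [a <= P E]. *)
Definition prob_ge (a : R) (E : set Omega) :=
  exists A : set Omega, [/\ measurable A, A `<=` E & (a%:E <= P A)%E].

Lemma prob_geP (a : R) (E : set Omega) : measurable E ->
  prob_ge a E <-> (a%:E <= P E)%E.
Proof.
move=> mE; split=> [[A [mA AE aA]]|aE]; last by exists E; split.
exact: le_trans aA (le_measure P (mem_set mA) (mem_set mE) AE).
Qed.

Definition mutually_independent {d'} {T : measurableType d'} {I : finType}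
    (Y : I -> Omega -> T) :=
  forall (J : {set I}) (A : I -> set T), (forall i, measurable (A i)) ->
    P (\bigcap_(i in [set` J]) (Y i @^-1` A i)) =
    (\prod_(i in J) P (Y i @^-1` A i))%E.

End prob.

(* Joint measurability on R^k x T, where R^k carries the product sigma-algebra
   that the library puts on [k.-tuple R]. *)
Definition jointly_measurable {R : realType} {k : nat} {d'}
    {T : measurableType d'} (g : 'cV[R]_k -> T -> R) :=
  measurable_fun [set: k.-tuple R * T]
    (fun z => g (\col_j tnth z.1 j) z.2).

(* Main.v *)
(** Write [delta = thetahat - theta], with blocks [delta_j], and let [a_j], [b_j]
    be the [l1] norms of [delta_j] on and off the support [J_j] of [theta_j].
    On the event of condition 3, optimality of [thetahat] and condition 2 give
    [sum_j z_j^2 + (L/K) sum_j (b_j - K a_j) <= 0], where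
    [z_j = |X delta_j| / (kappa sqrt N)].  A block in the cone [b_j <= K a_j] is
    controlled by the restricted eigenvalue condition.  A block outside the cone
    is compared with a vector of the cone obtained by shrinking its tail, at a
    cost proportional to the excess [e_j = b_j - K a_j]; the displayed inequality
    bounds [sum_j e_j], and excludes an excess when there is only one block. *)

Require Import Defs.
From HB Require Import structures.
From mathcomp Require Import all_boot all_order all_algebra.
From mathcomp Require Import ring lra.
From mathcomp Require Import all_classical all_reals all_analysis.

Import Order.TTheory GRing.Theory Num.Theory.
Import numFieldNormedType.Exports.

Local Open Scope classical_set_scope.
Local Open Scope ring_scope.

Local Notation proj := Defs.proj.

(** * Finite sums and selection of the largest entries *)

Lemma cauchy_schwarz_sum (R : realFieldType) (I : finType) (Q : pred I)
    (a b : I -> R) :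
  (\sum_(h | Q h) a h * b h) ^+ 2 <=
  (\sum_(h | Q h) a h ^+ 2) * (\sum_(h | Q h) b h ^+ 2).
Proof.
set A := \sum_(h | Q h) a h ^+ 2; set B := \sum_(h | Q h) b h ^+ 2.
have AB : A * B = \sum_(h | Q h) \sum_(g | Q g) a h ^+ 2 * b g ^+ 2.
  by rewrite big_distrlr.
have BA : A * B = \sum_(h | Q h) \sum_(g | Q g) a g ^+ 2 * b h ^+ 2.
  by rewrite AB exchange_big.
(* Doubling gives one copy of [A * B] for each order of summation; the termwise gap is then the
   square of [a h * b g - a g * b h]. *)
suff : 2 * (\sum_(h | Q h) a h * b h) ^+ 2 <= A * B + A * B by lra.
rewrite {1}AB BA -big_split expr2 big_distrlr mulr_sumr /=.
apply: ler_sum => h _; rewrite mulr_sumr -big_split /=.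
by apply: ler_sum => g _; have := sqr_ge0 (a h * b g - a g * b h); nra.
Qed.

Lemma sum_sqr_le_sqr_sum (R : realDomainType) (I : finType) (Q : pred I)
    (a : I -> R) : (forall i, Q i -> 0 <= a i) ->
  \sum_(i | Q i) a i ^+ 2 <= (\sum_(i | Q i) a i) ^+ 2.
Proof.
move=> a0; rewrite expr2 mulr_suml; apply: ler_sum => i Qi.
rewrite expr2 ler_wpM2l ?a0// (bigD1 i)//= lerDl.
by apply: sumr_ge0 => j /andP[Qj _]; exact: a0.
Qed.

Lemma exists_top_subset (R : realDomainType) (I : finType) (f : I -> R)
    (A : {set I}) (s : nat) : (s <= #|A|)%N ->
  exists T : {set I}, [/\ T \subset A, #|T| = s &
    forall i j, i \in T -> j \in A -> j \notin T -> f j <= f i].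
Proof.
elim: s => [|s IH] sA.
  by exists finset.set0; rewrite finset.sub0set cards0; split=> // i j; rewrite inE.
have [T [TA Ts Tf]] := IH (ltnW sA).
have : (0 < #|A :\: T|)%N by rewrite cardsDS// Ts subn_gt0.
case/card_gt0P => i0 i0AT.
have [i iAT imax] : exists2 i, i \in (A :\: T)%SET &
    forall j, j \in (A :\: T)%SET -> f j <= f i.
  by case: (arg_maxP f i0AT) => i iAT imax; exists i.
have [iA iT] : i \in A /\ i \notin T by move: iAT; rewrite inE => /andP[].
exists (i |: T)%SET; split.
- by rewrite finset.subUset finset.sub1set iA.
- by rewrite cardsU1 iT Ts.
- move=> h j; rewrite !inE negb_or => /orP[/eqP->|hT] jA /andP[ji jT].
    by apply: imax; rewrite inE jT.
  exact: Tf.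
Qed.

(** * Norms, coordinate projections and supports *)

Section norms.
Context {R : realType} {n : nat}.
Implicit Types (v w : 'cV[R]_n) (J : {set 'I_n}).

Lemma l1norm_ge0 v : 0 <= l1norm v.
Proof. by apply: sumr_ge0. Qed.

Lemma l2norm_ge0 v : 0 <= l2norm v.
Proof. exact: sqrtr_ge0. Qed.

Lemma sqr_l2norm v : l2norm v ^+ 2 = \sum_h v h 0 ^+ 2.
Proof. by rewrite sqr_sqrtr// sumr_ge0// => h _; rewrite sqr_ge0. Qed.

Lemma l2norm_triangle v w : l2norm (v + w) <= l2norm v + l2norm w.
Proof.
rewrite -(ler_pXn2r (n := 2))// ?nnegrE ?addr_ge0 ?l2norm_ge0//.
have CS : \sum_h v h 0 * w h 0 <= l2norm v * l2norm w.
  apply: le_trans (ler_norm _) _.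
  rewrite -(ler_pXn2r (n := 2))// ?nnegrE ?mulr_ge0 ?l2norm_ge0//.
  by rewrite exprMn !sqr_l2norm real_normK ?num_real// cauchy_schwarz_sum.
have -> : l2norm (v + w) ^+ 2 =
    l2norm v ^+ 2 + 2 * (\sum_h v h 0 * w h 0) + l2norm w ^+ 2.
  rewrite !sqr_l2norm mulr_sumr -!big_split /=.
  by apply: eq_bigr => h _; rewrite mxE; ring.
by nra.
Qed.

Lemma l2norm0 : l2norm (0 : 'cV[R]_n) = 0.
Proof. by rewrite /l2norm big1 ?sqrtr0// => h _; rewrite mxE expr0n. Qed.

Lemma l2norm_eq0 v : l2norm v = 0 -> v = 0.
Proof.
move=> v0; have /psumr_eq0P H : \sum_h v h 0 ^+ 2 = 0.
  by rewrite -sqr_l2norm v0 expr0n.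
apply/matrixP => h j; rewrite ord1 mxE; apply/eqP.
by rewrite -sqrf_eq0 H// => i _; rewrite sqr_ge0.
Qed.

Lemma l1norm_proj J v : l1norm (proj J v) = \sum_(h in J) `|v h 0|.
Proof.
rewrite [RHS]big_mkcond; apply: eq_bigr => h _.
by rewrite mxE; case: ifP; rewrite ?normr0.
Qed.

Lemma sqr_l2norm_proj J v : l2norm (proj J v) ^+ 2 = \sum_(h in J) v h 0 ^+ 2.
Proof.
rewrite sqr_l2norm [RHS]big_mkcond; apply: eq_bigr => h _.
by rewrite mxE; case: ifP; rewrite ?expr0n.
Qed.

Lemma proj_split J v : proj J v + proj (~: J)%SET v = v.
Proof.
apply/matrixP => h j; rewrite !mxE ord1 inE.
by case: (h \in J); rewrite ?addr0 ?add0r.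
Qed.

Lemma l1norm_split J v :
  l1norm v = l1norm (proj J v) + l1norm (proj (~: J)%SET v).
Proof.
rewrite !l1norm_proj /l1norm (bigID (mem J)) /=; congr (_ + _).
by apply: eq_bigl => h; rewrite inE.
Qed.

Lemma sqr_l2norm_split J v :
  l2norm v ^+ 2 = l2norm (proj J v) ^+ 2 + l2norm (proj (~: J)%SET v) ^+ 2.
Proof.
rewrite !sqr_l2norm_proj sqr_l2norm (bigID (mem J)) /=; congr (_ + _).
by apply: eq_bigl => h; rewrite inE.
Qed.

Lemma spt_proj J v : (#|spt (proj J v)| <= #|J|)%N.
Proof.
apply: subset_leq_card; apply/fintype.subsetP => h; rewrite inE mxE.
by case: ifP; rewrite ?eqxx.
Qed.

Lemma spt_eq0 v : #|spt v| = 0%N -> v = 0.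
Proof.
move/eqP; rewrite cards_eq0 => /eqP v0; apply/matrixP => h j.
by rewrite ord1 mxE; apply/eqP; have := finset.in_set0 h; rewrite -v0 inE => /negbFE.
Qed.

(** Cauchy-Schwarz against the constant 1; [s] stands for the square root of a sparsity level. *)
Lemma l1norm_proj_le_l2norm J v (s : R) : 0 <= s -> #|J|%:R <= s ^+ 2 ->
  l1norm (proj J v) <= s * l2norm (proj J v).
Proof.
move=> s0 Js.
rewrite -(ler_pXn2r (n := 2))// ?nnegrE ?mulr_ge0 ?l2norm_ge0 ?l1norm_ge0//.
rewrite exprMn sqr_l2norm_proj l1norm_proj.
have := cauchy_schwarz_sum _ _ (mem J) (fun h => 1) (fun h => `|v h 0|).
under eq_bigr do rewrite mul1r.
move=> /le_trans; apply.
under [X in _ * X]eq_bigr do rewrite real_normK ?num_real//.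
rewrite expr1n sumr_const ler_wpM2r// sumr_ge0// => h _.
by rewrite sqr_ge0.
Qed.

Lemma l2norm_le_of_bounded v (s mu : R) : 0 <= s -> 0 <= mu ->
  #|spt v|%:R <= s ^+ 2 -> (forall h, `|v h 0| <= mu) -> l2norm v <= s * mu.
Proof.
move=> s0 mu0 vs vmu.
rewrite -(ler_pXn2r (n := 2))// ?nnegrE ?mulr_ge0 ?l2norm_ge0//.
have -> : l2norm v ^+ 2 = \sum_(h in spt v) v h 0 ^+ 2.
  rewrite sqr_l2norm [RHS]big_mkcond; apply: eq_bigr => h _.
  by rewrite inE; case: eqP => //= ->; rewrite expr0n.
apply: (@le_trans _ _ (\sum_(h in spt v) mu ^+ 2)).
  apply: ler_sum => h _; rewrite -real_normK ?num_real//.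
  by rewrite ler_pXn2r ?nnegrE.
by rewrite sumr_const -[X in X <= _]mulr_natl exprMn ler_wpM2r ?sqr_ge0.
Qed.

(** Off the support of [x], [y - x] is [y]; on it, the triangle inequality applies. This turns a
    penalty difference into the masses of the error on and off the support. *)
Lemma l1norm_sub_le_spt (x y : 'cV[R]_n) :
  l1norm x - l1norm y <= l1norm (proj (spt x) (y - x))
                         - l1norm (proj (~: spt x)%SET (y - x)).
Proof.
rewrite (l1norm_split (spt x) x) (l1norm_split (spt x) y).
have -> : l1norm (proj (~: spt x)%SET x) = 0.
  by rewrite l1norm_proj big1// => h; rewrite !inE negbK => /eqP ->; rewrite normr0.
have -> : l1norm (proj (~: spt x)%SET (y - x)) = l1norm (proj (~: spt x)%SET y).
  rewrite !l1norm_proj; apply: eq_bigr => h; rewrite !inE negbK !mxE => /eqP ->.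
  by rewrite subr0.
suff : l1norm (proj (spt x) x) <=
    l1norm (proj (spt x) y) + l1norm (proj (spt x) (y - x)) by lra.
rewrite !l1norm_proj -big_split; apply: ler_sum => h _ /=; rewrite !mxE.
have -> : x h 0 = y h 0 - (y h 0 - x h 0) by rewrite subKr.
by apply: le_trans (ler_normB _ _) _; rewrite subKr.
Qed.

End norms.

(** * Action of the design on vectors with small entries *)

(* Shelling: [w] is cut into pieces of [S] coordinates of decreasing magnitude;
   the entries of a piece are at most the mean of the previous piece, so the
   [l2] norm of a piece is at most the [l1] norm of the previous one over
   [sqrt S]. *)
Lemma sparse_operator_bound (R : realType) (N m S : nat) (X : 'M[R]_(N, m))
    (sigma s : R) : (0 < S)%N -> 0 < s -> s ^+ 2 = S%:R -> 0 <= sigma ->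
  (forall v : 'cV[R]_m, (#|spt v| <= S)%N ->
     l2norm (X *m v) <= sigma * l2norm v) ->
  forall (w : 'cV[R]_m) (mu : R), 0 <= mu -> (forall h, `|w h 0| <= mu) ->
  l2norm (X *m w) <= sigma * (s * mu + l1norm w / s).
Proof.
move=> S0 s0 sS sigma0 Hsigma w.
(* Induction on the support size; [mu] stays general, to be replaced by the mean of the removed
   piece. *)
have [c] := ubnP #|spt w|; elim: c w => // c IH w wc mu mu0 wmu.
have [wS|Sw] := leqP #|spt w| S.
  apply: le_trans (Hsigma _ wS) _; rewrite ler_wpM2l//.
  apply: le_trans (_ : s * mu <= _); last first.
    by rewrite lerDl divr_ge0 ?l1norm_ge0// ltW.
  by apply: l2norm_le_of_bounded; rewrite ?(ltW s0) ?sS ?ler_nat.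
have [T [Tw TS Tf]] := exists_top_subset _ _ (fun h => `|w h 0|) _ _ (ltnW Sw).
set w' := proj (~: T)%SET w.
have spw' : (#|spt w'| < c)%N.
  apply: leq_trans (_ : #|spt w| <= _)%N; last by rewrite -ltnS.
  apply: proper_card; apply/properP; split.
    apply/fintype.subsetP => h; rewrite !inE mxE inE.
    by case: ifP; rewrite ?eqxx.
  have /card_gt0P[h hT] : (0 < #|T|)%N by rewrite TS.
  exists h; first exact: (fintype.subsetP Tw).
  by rewrite inE mxE inE hT eqxx.
have bw' h : `|w' h 0| <= l1norm (proj T w) / S%:R.
  rewrite mxE inE; case: ifP => [hT|_]; last first.
    by rewrite normr0 divr_ge0 ?l1norm_ge0.
  have [hw|hw] := boolP (h \in spt w); last first.
    move: hw; rewrite inE negbK => /eqP ->.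
    by rewrite normr0 divr_ge0 ?l1norm_ge0.
  rewrite ler_pdivlMr ?ltr0n// l1norm_proj mulr_natr -TS -sumr_const.
  by apply: ler_sum => i iT; exact: Tf.
have IHw := IH w' spw' _ (divr_ge0 (l1norm_ge0 _) (ler0n _ _)) bw'.
have -> : X *m w = X *m proj T w + X *m w' by rewrite -mulmxDr proj_split.
apply: le_trans (l2norm_triangle _ _) _.
have HT : l2norm (X *m proj T w) <= sigma * (s * mu).
  apply: le_trans (Hsigma _ _) _.
    by apply: leq_trans (spt_proj _ _) _; rewrite TS.
  rewrite ler_wpM2l// l2norm_le_of_bounded ?(ltW s0)//.
    rewrite sS ler_nat; apply: leq_trans (spt_proj _ _) _.
    by rewrite TS.
  by move=> h; rewrite mxE; case: ifP; rewrite ?normr0.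
(* The term [s * mu] pays for the piece [T]; [s] times the new [mu] is [l1norm (proj T w) / s],
   which completes the [l1] term. *)
rewrite mulrDr; apply: lerD => //; apply: le_trans IHw _.
rewrite (l1norm_split T w) -sS.
have -> : s * (l1norm (proj T w) / s ^+ 2) = l1norm (proj T w) / s.
  by field; rewrite gt_eqF.
by rewrite -mulrDl.
Qed.

(** * Error bounds in and near the cone *)

Lemma l1normZ (R : realType) (n : nat) (c : R) (v : 'cV[R]_n) :
  l1norm (c *: v) = `|c| * l1norm v.
Proof. by rewrite mulr_sumr; apply: eq_bigr => h _; rewrite mxE normrM. Qed.

Lemma sum_setU (V : nmodType) (I : finType) (J T : {set I}) (F : I -> V) :
  T \subset ~: J ->
  \sum_(h in (J :|: T)%SET) F h = \sum_(h in J) F h + \sum_(h in T) F h.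
Proof.
move=> TJ; rewrite -bigU; first by apply: eq_bigl => h; rewrite !inE.
by rewrite disjoint_sym finset.disjoints_subset.
Qed.

(** Here [x] is a norm on a coordinate set, [y] the squared norm of the tail, [z] the scaled
    prediction norm, [f] the scaled excess. Expanding the square gives [y <= (K^2 x^2 + f^2) / 2];
    the constant 15/2 is shared with the off-cone case. *)
Lemma tail_bound_of_cone (R : realFieldType) (K rho x z y f : R) :
  1 < K -> 1 <= rho -> 0 <= x -> 0 <= f -> x <= z ->
  4 * y <= (K * x + f) ^+ 2 ->
  x ^+ 2 + y <= (2 + K ^+ 2 / 2) * z ^+ 2 + 15 / 2 * rho ^+ 2 * f ^+ 2.
Proof.
move=> K1 rho1 x0 f0 xz hy.
have xz2 : x ^+ 2 <= z ^+ 2 by nra.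
have h1 : (K * x + f) ^+ 2 <= 2 * K ^+ 2 * x ^+ 2 + 2 * f ^+ 2.
  by have := sqr_ge0 (K * x - f); nra.
have h2 : K ^+ 2 * x ^+ 2 <= K ^+ 2 * z ^+ 2 by rewrite ler_wpM2l ?sqr_ge0.
have h3 : 1 * f ^+ 2 <= rho ^+ 2 * f ^+ 2.
  by rewrite ler_wpM2r ?sqr_ge0// -(expr1n _ 2) ler_pXn2r ?nnegrE//; lra.
have := sqr_ge0 f; have := sqr_ge0 z; nra.
Qed.

(** As [1 + K >= 2], [y <= f x + f^2 / 2 <= x^2 / 2 + f^2]. The cross term of [(z + rho f)^2] is
    split by the square of [z - 3 rho f], so that [3/2 x^2] costs [2 z^2]. *)
Lemma tail_bound_off_cone (R : realFieldType) (K rho x z y f : R) :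
  1 < K -> 1 <= rho -> 0 <= x -> 0 <= f -> x <= z + rho * f ->
  (1 + K) * y <= f * (K * x + f) ->
  x ^+ 2 + y <= (2 + K ^+ 2 / 2) * z ^+ 2 + 15 / 2 * rho ^+ 2 * f ^+ 2.
Proof.
move=> K1 rho1 x0 f0 xz hy.
have hy' : y <= f * x + f ^+ 2 / 2.
  suff : (1 + K) * y <= (1 + K) * (f * x + f ^+ 2 / 2) by rewrite ler_pM2l//; lra.
  apply: le_trans hy _; have := mulr_ge0 f0 x0; have := sqr_ge0 f; nra.
have h1 : f * x <= x ^+ 2 / 2 + f ^+ 2 / 2 by have := sqr_ge0 (x - f); nra.
have h2 : 3 / 2 * x ^+ 2 <= 2 * z ^+ 2 + 6 * (rho * f) ^+ 2.
  have : x ^+ 2 <= (z + rho * f) ^+ 2 by rewrite ler_pXn2r ?nnegrE//; lra.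
  by have := sqr_ge0 (z - 3 * (rho * f)); nra.
have h3 : 1 * f ^+ 2 <= rho ^+ 2 * f ^+ 2.
  by rewrite ler_wpM2r ?sqr_ge0// -(expr1n _ 2) ler_pXn2r ?nnegrE//; lra.
have h4 : 0 <= K ^+ 2 * z ^+ 2 by rewrite mulr_ge0 ?sqr_ge0.
rewrite exprMn in h2; have := sqr_ge0 f; nra.
Qed.

(* [T] collects the [S] largest coordinates of [v] off [J]. If [v] violates the
   cone condition for [J :|: T], its tail off [J :|: T] is scaled down until the
   condition holds; [X] moves by at most [sigma * e / s] under this change. *)
Lemma near_cone_bound (R : realType) (N m S : nat) (X : 'M[R]_(N, m))
    (sigma s c K : R) : (0 < S)%N -> (2 * S <= m)%N ->
  0 < s -> s ^+ 2 = S%:R -> 0 < c -> c <= sigma -> 1 < K ->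
  (forall v : 'cV[R]_m, (#|spt v| <= S)%N ->
     l2norm (X *m v) <= sigma * l2norm v) ->
  (forall (v : 'cV[R]_m) (J : {set 'I_m}), (1 <= #|J| <= 2 * S)%N ->
     l1norm (proj (~: J)%SET v) <= K * l1norm (proj J v) ->
     c * l2norm (proj J v) <= l2norm (X *m v)) ->
  forall (v : 'cV[R]_m) (J : {set 'I_m}) (e : R), (#|J| <= S)%N -> 0 <= e ->
  l1norm (proj (~: J)%SET v) <= K * l1norm (proj J v) + e ->
  l2norm v ^+ 2 <= (2 + K ^+ 2 / 2) * (l2norm (X *m v) / c) ^+ 2
                   + 15 / 2 * (sigma / c) ^+ 2 * (e / s) ^+ 2 /\
  (e = 0 -> l1norm (proj J v) <= s * (l2norm (X *m v) / c)).
Proof.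
move=> S0 S2 s0 sS c0 csigma K1 Hsigma Hcone v J e JS e0 He.
have sigma0 : 0 <= sigma by apply: le_trans csigma; exact: ltW.
(* [2 * S <= m] leaves at least [S] coordinates off [J], enough to choose [T]. *)
have SJ : (S <= #|~: J|)%N.
  have := cardsC J; rewrite card_ord => mE.
  by rewrite -(leq_add2l #|J|) mE; apply: leq_trans S2;
    rewrite mul2n -addnn leq_add2r.
have [T [TJ TS Tf]] := exists_top_subset _ _ (fun h => `|v h 0|) _ _ SJ.
pose J' := (J :|: T)%SET.
pose a := l1norm (proj J v); pose b := l1norm (proj (~: J)%SET v).
pose tau := l1norm (proj T v); pose b' := l1norm (proj (~: J')%SET v).
pose x := l2norm (proj J' v); pose r := proj (~: J')%SET v.
have J'S : (1 <= #|J'| <= 2 * S)%N.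
  apply/andP; split.
    by apply: leq_trans S0 _; rewrite -TS subset_leq_card// finset.subsetUr.
  rewrite (leq_trans (leq_card_setU _ _))//.
  by rewrite mul2n -addnn leq_add// TS.
have aE : l1norm (proj J' v) = a + tau by rewrite /a /tau !l1norm_proj sum_setU.
have bE : b = tau + b'.
  have := l1norm_split J v; rewrite (l1norm_split J') aE -/a -/b -/b'; lra.
have [a0 tau0 b'0] : [/\ 0 <= a, 0 <= tau & 0 <= b'] by rewrite !l1norm_ge0.
have x0 : 0 <= x by exact: l2norm_ge0.
have ax : a <= s * x.
  apply: (@le_trans _ _ (s * l2norm (proj J v))).
    by rewrite l1norm_proj_le_l2norm ?(ltW s0)// sS ler_nat.
  rewrite ler_wpM2l ?(ltW s0)// -(ler_pXn2r (n := 2))// ?nnegrE ?l2norm_ge0//.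
  by rewrite !sqr_l2norm_proj sum_setU// lerDl sumr_ge0// => h _; rewrite sqr_ge0.
have rb h : `|r h 0| <= tau / S%:R.
  rewrite mxE; case: ifP => [|_]; last by rewrite normr0 divr_ge0.
  rewrite !inE negb_or => /andP[hJ hT].
  rewrite ler_pdivlMr ?ltr0n// /tau l1norm_proj mulr_natr -TS -sumr_const.
  by apply: ler_sum => i iT; apply: Tf => //; rewrite inE.
(* The entries of [r] are at most the mean [tau / S], so its squared norm is at most that mean times
   its [l1] norm [b']. *)
have hr : s ^+ 2 * l2norm r ^+ 2 <= tau * b'.
  rewrite sS -ler_pdivlMl ?ltr0n// mulrA [_^-1 * _]mulrC.
  rewrite sqr_l2norm_proj /b' l1norm_proj mulr_sumr; apply: ler_sum => h hJ'.
  rewrite -real_normK ?num_real// expr2 ler_wpM2r//.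
  by have := rb h; rewrite mxE hJ'.
have hrf : l2norm r ^+ 2 <= tau * b' / s ^+ 2.
  by rewrite ler_pdivlMr ?exprn_gt0// mulrC.
have vE : l2norm v ^+ 2 = x ^+ 2 + l2norm r ^+ 2 by exact: sqr_l2norm_split.
have f0 : 0 <= e / s by rewrite divr_ge0// ltW.
have eE : e = s * (e / s) by field; rewrite gt_eqF.
have rho1 : 1 <= sigma / c by rewrite ler_pdivlMr// mul1r.
have [b'K|Kb'] := leP b' (K * (a + tau)).
  have xz : x <= l2norm (X *m v) / c.
    by rewrite ler_pdivlMr// mulrC Hcone// aE.
  split; last by move=> _; apply: le_trans ax _; rewrite ler_wpM2l// ltW.
  rewrite vE; apply: tail_bound_of_cone => //.
  suff : s ^+ 2 * (4 * l2norm r ^+ 2) <= s ^+ 2 * (K * x + e / s) ^+ 2.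
    by rewrite ler_pM2l// exprn_gt0.
  have -> : s ^+ 2 * (K * x + e / s) ^+ 2 = (K * (s * x) + e) ^+ 2.
    by rewrite -exprMn mulrDr -eE; congr ((_ + _) ^+ 2); ring.
  have h1 : tau + b' <= K * (s * x) + e.
    rewrite -bE; apply: le_trans He _; rewrite lerD2r ler_wpM2l//; lra.
  have h2 : (tau + b') ^+ 2 <= (K * (s * x) + e) ^+ 2.
    by rewrite ler_pXn2r// nnegrE; lra.
  (* [4 tau b' <= (tau + b')^2]. *)
  have := sqr_ge0 (tau - b'); nra.
have b'_gt0 : 0 < b' by apply: le_lt_trans Kb'; rewrite mulr_ge0 ?addr_ge0//; lra.
rewrite -/b -/a bE in He.
(* The factor [t] brings the tail exactly to the boundary of the cone for [J']. *)
pose t := K * (a + tau) / b'.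
have t0 : 0 <= t by rewrite divr_ge0// mulr_ge0 ?addr_ge0//; lra.
have t1 : t <= 1 by rewrite ler_pdivrMr// mul1r ltW.
have tb' : t * b' = K * (a + tau) by rewrite /t divfK// gt_eqF.
pose v' := v + (t - 1) *: r.
have v'J' : proj J' v' = proj J' v.
  apply/matrixP => h j; rewrite !mxE finset.in_setC.
  by case: (h \in J') => //=; rewrite mulr0 addr0.
have v'Jc : proj (~: J')%SET v' = t *: r.
  apply/matrixP => h j; rewrite !mxE.
  by case: (h \in (~: J')%SET) => //=; ring.
have cx : c * x <= l2norm (X *m v').
  rewrite /x -v'J'; apply: Hcone => //.
  by rewrite v'J' v'Jc l1normZ aE ger0_norm// tb'.
have Xr : l2norm (X *m ((t - 1) *: r)) <= sigma * (e / s).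
  have mu0 : 0 <= (1 - t) * (tau / S%:R) by rewrite mulr_ge0 ?divr_ge0//; lra.
  have nt : `|t - 1| = 1 - t by rewrite ler0_norm; lra.
  have wb h : `|((t - 1) *: r) h 0| <= (1 - t) * (tau / S%:R).
    by rewrite [X in `|X|]mxE normrM nt ler_wpM2l//; lra.
  have := sparse_operator_bound _ _ _ _ X _ _ S0 s0 sS sigma0 Hsigma _ _ mu0 wb.
  move/le_trans; apply; rewrite ler_wpM2l// l1normZ nt.
  have -> : s * ((1 - t) * (tau / S%:R)) + (1 - t) * l1norm r / s =
            ((1 - t) * (tau + b')) / s.
    by rewrite -sS /b' -/r; field; rewrite gt_eqF.
  (* What remains is [(1 - t) * (tau + b') <= e]: substitute [t * b' = K * (a + tau)] and use
     [He]. *)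
  rewrite ler_pM2r ?invr_gt0//.
  have : 0 <= t * tau by rewrite mulr_ge0.
  have : 0 <= K * tau by rewrite mulr_ge0//; lra.
  rewrite mulrDr mulrBl mulrBl tb'; lra.
have xz : x <= l2norm (X *m v) / c + sigma / c * (e / s).
  have -> : l2norm (X *m v) / c + sigma / c * (e / s) =
            (l2norm (X *m v) + sigma * (e / s)) / c by field; rewrite !gt_eqF.
  rewrite ler_pdivlMr// mulrC; apply: le_trans cx _.
  rewrite mulmxDr; apply: le_trans (l2norm_triangle _ _) _.
  by rewrite lerD2l.
split; last first.
  by move=> e00; move: xz; rewrite e00 mul0r mulr0 addr0 => xz;
    apply: le_trans ax _; rewrite ler_wpM2l// ltW.
rewrite vE; apply: tail_bound_off_cone => //.
(* Combine [b' > K * (a + tau)] with [tau + b' <= K * a + e]. *)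
have taue : (1 + K) * tau <= e by nra.
suff : s ^+ 2 * ((1 + K) * l2norm r ^+ 2) <= s ^+ 2 * (e / s * (K * x + e / s)).
  by rewrite ler_pM2l// exprn_gt0.
have -> : s ^+ 2 * (e / s * (K * x + e / s)) = e * (K * (s * x) + e).
  by field; rewrite gt_eqF.
have h1 : b' <= K * (s * x) + e.
  have : K * a <= K * (s * x) by rewrite ler_wpM2l//; lra.
  lra.
have h2 : (1 + K) * tau * b' <= e * (K * (s * x) + e).
  by apply: ler_pM => //; rewrite mulr_ge0//; lra.
have : (1 + K) * (s ^+ 2 * l2norm r ^+ 2) <= (1 + K) * (tau * b').
  by rewrite ler_wpM2l//; lra.
by rewrite mulrCA; move=> /le_trans; apply; rewrite mulrA.
Qed.

(** * Summation over the blocks *)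

(* The excess is bounded by completing the square, [L s z_j - z_j^2 <= L^2 s^2 / 4]:
   the factor 4 is needed, since [e_j] enters squared with constant 15/2. *)
Lemma sum_excess_bound (R : realFieldType) (k : nat) (K L s rho : R)
    (a b z n : 'I_k -> R) : (1 <= k)%N -> 1 < K -> 0 < L -> 0 < s ->
  (forall j, 0 <= b j) -> (forall j, 0 <= z j) ->
  \sum_j z j ^+ 2 + L / K * \sum_j (b j - K * a j) <= 0 ->
  (forall j e, 0 <= e -> b j <= K * a j + e ->
     n j <= (2 + K ^+ 2 / 2) * z j ^+ 2 + 15 / 2 * rho ^+ 2 * (e / s) ^+ 2 /\
     (e = 0 -> a j <= s * z j)) ->
  \sum_j n j <= k%:R * L ^+ 2 * s ^+ 2 *
    (2 + K ^+ 2 + 2 * (1 + K ^+ 2) * (1 + rho ^+ 2 * k%:R) * (1 < k)%N%:R).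
Proof.
move=> k1 K1 L0 s0 b0 z0 H Hn.
have K0 : 0 < K by lra.
have LK : 0 < L / K by rewrite divr_gt0.
pose e j := Num.max 0 (b j - K * a j).
have e0 j : 0 <= e j by rewrite le_max lexx.
have eb j : b j <= K * a j + e j by rewrite -lerBlDl le_max lexx orbT.
have Ls0 : 0 < L * s by rewrite mulr_gt0.
(* With a positive excess, [L / K * e j] is the right side. Without one, [e j = 0] and the cone
   clause of [Hn] gives [a j <= s * z j]. *)
have term j : L / K * e j - L * s * z j <= L / K * (b j - K * a j).
  have [be|be] := leP (b j - K * a j) 0; last first.
    by rewrite /e max_r ?(ltW be)// lerBlDr lerDl mulr_ge0// ltW.
  have ej : e j = 0 by rewrite /e max_l.
  have [_ /(_ ej) az] := Hn j (e j) (e0 j) (eb j).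
  rewrite ej mulr0 sub0r.
  have -> : L / K * (b j - K * a j) = L / K * b j - L * a j.
    by field; rewrite gt_eqF.
  have : 0 <= L / K * b j by rewrite mulr_ge0// ltW.
  have : L * a j <= L * (s * z j) by rewrite ler_pM2l.
  lra.
rewrite mulr_sumr in H.
have zsum : \sum_j z j ^+ 2 <= k%:R * (L * s) ^+ 2.
  have : \sum_j (z j ^+ 2 - (L * s) ^+ 2) <= 0.
    (* The gap between [2 (z^2 - L s z)] and [z^2 - (L s)^2] is the square of [z - L s]. *)
    suff : \sum_j (z j ^+ 2 - (L * s) ^+ 2) <=
        2 * (\sum_j z j ^+ 2 + \sum_j (L / K * (b j - K * a j))) by lra.
    rewrite -big_split mulr_sumr; apply: ler_sum => j _ /=.
    have := term j; have := sqr_ge0 (z j - L * s).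
    have : 0 <= L / K * e j by rewrite mulr_ge0// ltW.
    nra.
  by rewrite sumrB sumr_const card_ord -mulr_natl; lra.
have esum : \sum_j e j / s <= k%:R * (K * L * s) / 4.
  have : \sum_j (e j / s - K * L * s / 4) <= 0.
    (* The factor turns the weight [L / K] of [e j] into [1 / s]. *)
    suff : \sum_j (e j / s - K * L * s / 4) <= K / (L * s) *
        (\sum_j z j ^+ 2 + \sum_j (L / K * (b j - K * a j))).
      by move/le_trans; apply; rewrite pmulr_rle0// divr_gt0.
    rewrite -big_split mulr_sumr; apply: ler_sum => j _ /=.
    rewrite -[leLHS](mulVKf (x := K / (L * s))) ?mulf_neq0 ?invr_eq0 ?gt_eqF//.
    rewrite ler_pM2l ?divr_gt0//.
    have -> : (K / (L * s))^-1 * (e j / s - K * L * s / 4) =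
        L / K * e j - (L * s) ^+ 2 / 4 by field; rewrite !gt_eqF.
    have := term j; have := sqr_ge0 (z j - L * s / 2); lra.
  by rewrite sumrB sumr_const card_ord -mulr_natl; lra.
have e2sum : \sum_j (e j / s) ^+ 2 <=
    (k%:R * (K * L * s) / 4) ^+ 2 * (1 < k)%N%:R.
  have [k2|] := ltnP 1 k.
    have es0 j : 0 <= e j / s by rewrite divr_ge0// ltW.
    rewrite mulr1; apply: le_trans (sum_sqr_le_sqr_sum _ _ _ _ _) _ => //.
    have ess0 : 0 <= \sum_j e j / s by apply: sumr_ge0.
    rewrite ler_pXn2r ?nnegrE//; exact: le_trans esum.
  (* A single block has no excess, since [H] would bound a square plus a positive term by 0. Hence
     the indicator of [k > 1]. *)
  move=> k1'; have kE : k = 1%N by apply/eqP; rewrite eqn_leq k1 k1'.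
  subst k; rewrite mulr0 !big_ord1 /= in H *.
  have -> : e 0 = 0.
    rewrite /e max_l// leNgt; apply/negP => be.
    have : 0 < L / K * (b 0 - K * a 0) by rewrite mulr_gt0.
    by have := sqr_ge0 (z 0); lra.
  by rewrite mul0r expr0n.
apply: (@le_trans _ _ ((2 + K ^+ 2 / 2) * \sum_j z j ^+ 2 +
    15 / 2 * rho ^+ 2 * \sum_j (e j / s) ^+ 2)).
  rewrite !mulr_sumr -big_split; apply: ler_sum => j _.
  by have [] := Hn j (e j) (e0 j) (eb j).
apply: (@le_trans _ _ ((2 + K ^+ 2 / 2) * (k%:R * (L * s) ^+ 2) +
    15 / 2 * rho ^+ 2 * ((k%:R * (K * L * s) / 4) ^+ 2 * (1 < k)%N%:R))).
  have := sqr_ge0 K; have := sqr_ge0 rho => rho0 K20.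
  by apply: lerD; rewrite ler_wpM2l//; lra.
set B : R := (1 < k)%N%:R; have B0 : 0 <= B by rewrite ler0n.
pose q : R := k%:R * L ^+ 2 * s ^+ 2.
have q0 : 0 <= q by rewrite mulr_ge0 ?sqr_ge0// mulr_ge0 ?sqr_ge0// ler0n.
(* 15/32 is 15/2 times the square of 1/4, well below the allowed 2. *)
have -> : (2 + K ^+ 2 / 2) * (k%:R * (L * s) ^+ 2) +
    15 / 2 * rho ^+ 2 * ((k%:R * (K * L * s) / 4) ^+ 2 * B) =
    q * (2 + K ^+ 2 / 2 + 15 / 32 * (K ^+ 2 * (rho ^+ 2 * k%:R)) * B).
  by rewrite /q; field.
rewrite ler_wpM2l// lerD//; first by have := sqr_ge0 K; lra.
rewrite ler_wpM2r//.
have r0 : 0 <= rho ^+ 2 * k%:R by rewrite mulr_ge0 ?sqr_ge0.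
have := sqr_ge0 K; have := mulr_ge0 (sqr_ge0 K) r0; lra.
Qed.

(** * Inequalities supplied by [sigmaX] and [kappaX] *)

Section design_constants.
Context {R : realType} {N m : nat}.
Variable X : 'M[R]_(N, m).

(** The Frobenius bound shows that the set defining [sigmaX] is bounded above, so that its [sup] is
    a genuine supremum. *)
Lemma l2norm_mulmx_le (v : 'cV[R]_m) :
  l2norm (X *m v) <= Num.sqrt (\sum_i \sum_h X i h ^+ 2) * l2norm v.
Proof.
have X0 : 0 <= \sum_i \sum_h X i h ^+ 2.
  by apply: sumr_ge0 => i _; apply: sumr_ge0 => h _; exact: sqr_ge0.
rewrite -(ler_pXn2r (n := 2))// ?nnegrE ?mulr_ge0 ?l2norm_ge0 ?sqrtr_ge0//.
rewrite exprMn !sqr_l2norm sqr_sqrtr// mulr_suml; apply: ler_sum => i _.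
by rewrite mxE cauchy_schwarz_sum.
Qed.

Lemma sigmaX_bound (l : nat) (v : 'cV[R]_m) : (#|spt v| <= l)%N ->
  l2norm (X *m v) <= sigmaX X l * l2norm v.
Proof.
move=> vl; have [v0|v0] := posnP #|spt v|.
  by rewrite (spt_eq0 _ v0) mulmx0 !l2norm0 mulr0.
have nv : 0 < l2norm v.
  rewrite lt_neqAle l2norm_ge0 andbT eq_sym; apply/eqP => /l2norm_eq0 ve.
  move: v0; rewrite ve => /card_gt0P[h].
  by rewrite inE mxE eqxx.
rewrite -ler_pdivrMr//; apply: ub_le_sup; last by exists v; rewrite ?v0.
exists (Num.sqrt (\sum_i \sum_h X i h ^+ 2)) => _ [u _ ->].
have [u0|u0] := eqVneq (l2norm u) 0; first by rewrite u0 invr0 mulr0 sqrtr_ge0.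
by rewrite ler_pdivrMr ?l2norm_mulmx_le// lt_neqAle eq_sym u0 l2norm_ge0.
Qed.

(** A zero projection is trivial. Otherwise [v] is admissible, which bounds [kappaX] by a real, so
    [fine] loses nothing. *)
Lemma fine_kappaX_bound (s : nat) (K : R) (v : 'cV[R]_m) (J : {set 'I_m}) :
  (0 < N)%N -> (0 <= kappaX X s K)%E -> (1 <= #|J| <= s)%N ->
  l1norm (proj (~: J)%SET v) <= K * l1norm (proj J v) ->
  Num.sqrt N%:R * fine (kappaX X s K) * l2norm (proj J v) <= l2norm (X *m v).
Proof.
move=> N0 kappa0 Js vJ.
have [pv0|pv0] := eqVneq (l2norm (proj J v)) 0.
  by rewrite pv0 mulr0 l2norm_ge0.
have pv : 0 < l2norm (proj J v) by rewrite lt_neqAle eq_sym pv0 l2norm_ge0.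
have : (kappaX X s K <=
    (l2norm (X *m v) / (Num.sqrt N%:R * l2norm (proj J v)))%:E)%E.
  apply: ereal_inf_lbound; exists v, J; split => //.
  apply: contra_neq pv0 => ->.
  rewrite (_ : proj J 0 = 0) ?l2norm0//.
  by apply/matrixP => h j; rewrite !mxE; case: ifP.
move: kappa0; case: (kappaX X s K) => [r| |] //= _.
have sN : 0 < Num.sqrt N%:R :> R by rewrite sqrtr_gt0 ltr0n.
rewrite lee_fin ler_pdivlMr ?mulr_gt0//.
by rewrite mulrCA mulrA.
Qed.

(** A coordinate vector is admissible, so the infimum is finite and [fine] does not collapse it to
    0. *)
Lemma fine_kappaX_gt0 (s : nat) (K : R) : (0 < m)%N -> (0 < s)%N -> 0 <= K ->
  (0 < kappaX X s K)%E -> 0 < fine (kappaX X s K).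
Proof.
move=> m0 s0 K0 kappa0; apply: fine_gt0; rewrite kappa0 /=.
pose v : 'cV[R]_m := delta_mx (Ordinal m0) 0.
pose J : {set 'I_m} := [set Ordinal m0]%SET.
apply: le_lt_trans (ltry
  (l2norm (X *m v) / (Num.sqrt N%:R * l2norm (proj J v)))).
apply: ereal_inf_lbound; exists v, J; split=> //; last by rewrite cards1.
  by apply/eqP => /matrixP/(_ (Ordinal m0) 0)/eqP; rewrite !mxE !eqxx oner_eq0.
rewrite (_ : l1norm (proj (~: J)%SET v) = 0) ?mulr_ge0 ?l1norm_ge0//.
rewrite l1norm_proj big1// => h; rewrite !inE => /negPf hJ.
by rewrite mxE hJ normr0.
Qed.

(** A unit coordinate vector is admissible for both constants. The comparison provides [c <= sigma]
    in [near_cone_bound]. *)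
Lemma kappaX_le_sigmaX (l s : nat) (K : R) :
  (0 < N)%N -> (0 < m)%N -> (0 < l)%N -> (0 < s)%N -> 0 <= K ->
  (0 <= kappaX X s K)%E -> Num.sqrt N%:R * fine (kappaX X s K) <= sigmaX X l.
Proof.
move=> N0 m0 l0 s0 K0 kappa0.
pose v : 'cV[R]_m := delta_mx (Ordinal m0) 0.
pose J : {set 'I_m} := [set Ordinal m0]%SET.
have vJ : proj J v = v.
  apply/matrixP => h j; rewrite ord1 !mxE !inE.
  by case: (h == _).
have v1 : l2norm v = 1.
  rewrite /l2norm (bigD1 (Ordinal m0))//= mxE !eqxx big1 ?addr0 ?expr1n ?sqrtr1//.
  by move=> h /negPf hm; rewrite mxE hm expr0n.
have Js : (1 <= #|J| <= s)%N by rewrite cards1.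
have vl : (#|spt v| <= l)%N.
  by rewrite -vJ; apply: leq_trans (spt_proj _ _) _; rewrite cards1.
have := fine_kappaX_bound s K v J N0 kappa0 Js.
rewrite vJ v1 !mulr1 => /(_ _)/le_trans; apply.
  rewrite (_ : l1norm (proj (~: J)%SET v) = 0) ?mulr_ge0 ?l1norm_ge0//.
  rewrite l1norm_proj big1// => h; rewrite !inE => /negPf hJ.
  by rewrite mxE hJ normr0.
by have := sigmaX_bound l v vl; rewrite v1 mulr1.
Qed.

End design_constants.

(** * Block structure of the parameter vector *)

Section blocks.
Context {R : realType} {k m : nat}.
Implicit Types u v : 'cV[R]_(k * m).

Lemma sum_mxvec_index (V : nmodType) (F : 'I_(k * m) -> V) :
  \sum_h F h = \sum_j \sum_h F (mxvec_index j h).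
Proof.
rewrite pair_big (reindex _ (curry_mxvec_bij k m)) /=.
by apply: eq_bigr => -[].
Qed.

Lemma blockB u v j : block (u - v) j = block u j - block v j.
Proof. by apply/matrixP => h i; rewrite !mxE. Qed.

Lemma l1norm_block v : l1norm v = \sum_j l1norm (block v j).
Proof.
rewrite {1}/l1norm sum_mxvec_index; apply: eq_bigr => j _.
by apply: eq_bigr => h _; rewrite mxE.
Qed.

Lemma sqr_l2norm_block v : l2norm v ^+ 2 = \sum_j l2norm (block v j) ^+ 2.
Proof.
rewrite sqr_l2norm sum_mxvec_index; apply: eq_bigr => j _.
by rewrite sqr_l2norm; apply: eq_bigr => h _; rewrite mxE.
Qed.

Lemma sum_sqr_l2norm_blockdiag (N : nat) (X : 'M[R]_(N, m)) v :
  \sum_(i < N) l2norm (blockdiag k (row i X) *m v) ^+ 2 =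
  \sum_(j < k) l2norm (X *m block v j) ^+ 2.
Proof.
under eq_bigr do rewrite sqr_l2norm.
rewrite exchange_big; apply: eq_bigr => j _; rewrite sqr_l2norm.
apply: eq_bigr => i _; rewrite blockdiag_mul; congr (_ ^+ 2).
by rewrite !mxE; apply: eq_bigr => h _; rewrite mxE.
Qed.

Lemma card_spt_block u j : (#|spt (block u j)| <= max_spt u)%N.
Proof. exact: (leq_bigmax j). Qed.

Lemma max_spt_eq0 u : max_spt u = 0%N -> u = 0.
Proof.
move=> u0; apply: l2norm_eq0; apply/eqP; rewrite -sqrf_eq0 sqr_l2norm_block.
rewrite big1// => j _; rewrite [block u j]spt_eq0; last first.
  by apply/eqP; rewrite -leqn0 -u0 card_spt_block.
by rewrite l2norm0 expr0n.
Qed.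

End blocks.

(** * From optimality of the estimator to the error bound *)

Lemma expectB (d : measure_display) (Omega : measurableType d) (R : realType)
    (P : probability Omega R) (f g : Omega -> R) :
  P.-integrable [set: Omega] (EFin \o f) ->
  P.-integrable [set: Omega] (EFin \o g) ->
  expect P (fun w => f w - g w) = expect P f - expect P g.
Proof.
move=> /Lfun1_integrable fL /Lfun1_integrable gL.
by rewrite /expect (expectationB fL gL) fineB// expectation_fin_num.
Qed.

Theorem theorem4p1 (R : realType)
  (d : measure_display) (Omega : measurableType d) (P : probability Omega R)
  (d' : measure_display) (T : measurableType d')
  (N k m : nat) (N_ge1 : (1 <= N)%N) (k_ge1 : (1 <= k)%N) (m_ge1 : (1 <= m)%N)
  (Y : 'I_N -> {RV P >-> T})
  (Y_indep : mutually_independent P (fun i => Y i : Omega -> T))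
  (gamma : 'I_N -> 'cV[R]_k -> T -> R)
  (gamma_meas : forall i, jointly_measurable (gamma i))
  (X : 'M[R]_(N, m)) (D : set 'cV[R]_(k * m)) (D_compact : compact D) :
  let Z (i : 'I_N) : 'M[R]_(k, k * m) := blockdiag k (row i X) in
  let loss (i : 'I_N) (u : 'cV[R]_(k * m)) (w : Omega) : R :=
    gamma i (Z i *m u) (Y i w) in
  forall (loss_integrable : forall i u, D u ->
      P.-integrable [set: Omega] (EFin \o loss i u))
    (theta : 'cV[R]_(k * m))
    (theta_argmin : is_argmin D (fun u => \sum_(i < N) expect P (loss i u)) theta),
  let S := max_spt theta in
  forall (S_lt : S%:R < m%:R / 2 :> R)
    (q : R) (q_gt0 : 0 < q) (q_lt1 : q < 1)
    (K : R) (K_gt1 : 1 < K)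
    (kappa_gt0 : (0 < kappaX X (2 * S) K)%E)
    (Cgamma : R) (Cgamma_gt0 : 0 < Cgamma)
    (quad_lower_bound : forall i u, D u ->
      Cgamma * l2norm (Z i *m (u - theta)) ^+ 2
        <= expect P (loss i u) - expect P (loss i theta))
    (Mq : R) (Mq_gt0 : 0 < Mq)
    (local_lipschitz : prob_ge P (1 - q) [set w | forall u, D u ->
      `|\sum_(i < N) centered P (fun w' => loss i u w' - loss i theta w') w|
        <= Mq * l1norm (u - theta)]),
  let kappa := fine (kappaX X (2 * S) K) in
  let lambda := (K + 1) * Mq / (K - 1) in
  let L_N := 2 * Mq * K / (N%:R * kappa ^+ 2 * Cgamma * (K - 1)) in
  forall (thetahat : Omega -> 'cV[R]_(k * m))
    (thetahat_argmin : forall w,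
      is_argmin D (fun u => \sum_(i < N) loss i u w + lambda * l1norm u)
        (thetahat w)),
  prob_ge P (1 - q) [set w |
    l2norm (thetahat w - theta) ^+ 2 <=
      k%:R * L_N ^+ 2 * S%:R *
        (2 + K ^+ 2 +
         2 * (1 + K ^+ 2) * (N%:R * kappa ^+ 2 + sigmaX X S ^+ 2 * k%:R)
           / (N%:R * kappa ^+ 2) * (1 < k)%N%:R)].
Proof.
move=> Z loss loss_integrable theta [Dtheta _] S S_lt q _ _ K K_gt1 kappa_gt0
  Cgamma C0 quad_lower_bound Mq Mq0 [A [mA Alip PA]] kappa lambda L thetahat
  argmin.
(* The Lipschitz event is the witness; from here on the outcome [w] is fixed. *)
exists A; split => // w /Alip /= {mA PA A Alip} lip.
set u := thetahat w; have [Du umin] := argmin w; rewrite -/u in Du umin.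
set delta := u - theta.
have K1 : 0 < K - 1 by lra.
(* Optimality against [theta] bounds the empirical loss gap; passing to the expected gap costs
   [Mq * l1norm delta]. *)
have excess : Cgamma * \sum_(i < N) l2norm (Z i *m delta) ^+ 2 <=
    Mq * l1norm delta + lambda * (l1norm theta - l1norm u).
  have quad : Cgamma * \sum_(i < N) l2norm (Z i *m delta) ^+ 2 <=
      \sum_(i < N) (expect P (loss i u) - expect P (loss i theta)).
    by rewrite mulr_sumr; apply: ler_sum => i _; exact: quad_lower_bound.
  have := umin _ Dtheta.
  have := lip _ Du; rewrite ler_norml -/delta => /andP[+ _].
  under eq_bigr do rewrite /centered expectB ?loss_integrable//.
  move: quad; rewrite !sumrB; lra.
(* [lambda] is such that [lambda + Mq = K * (lambda - Mq)]: the weights on and off the support are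
   in the ratio [K] of the cone. *)
have lambdaE1 : lambda + Mq = 2 * Mq / (K - 1) * K.
  by rewrite /lambda; field; rewrite gt_eqF.
have lambdaE2 : lambda - Mq = 2 * Mq / (K - 1).
  by rewrite /lambda; field; rewrite gt_eqF.
have c0 : 0 < 2 * Mq / (K - 1) by rewrite divr_gt0// mulr_gt0.
(* For [S = 0] no set [J] is admissible and [kappa] is the default 0. The claimed bound is 0, and
   [lambda > Mq] forces [u = theta = 0]. *)
have [S0|S0] := posnP S.
  have theta0 : theta = 0 by exact: max_spt_eq0.
  have l1_0 : l1norm (0 : 'cV[R]_(k * m)) = 0.
    by rewrite /l1norm big1// => h _; rewrite mxE normr0.
  rewrite S0 mulr0 mul0r -/delta; move: excess.
  rewrite /delta theta0 subr0 l1_0 sub0r => excess.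
  have sum0 : 0 <= Cgamma * \sum_(i < N) l2norm (Z i *m u) ^+ 2.
    by rewrite mulr_ge0 ?(ltW C0)// sumr_ge0// => i _; exact: sqr_ge0.
  have u0 : l1norm u <= 0.
    suff : 2 * Mq / (K - 1) * l1norm u <= 0 by rewrite pmulr_rle0.
    by rewrite -lambdaE2; lra.
  rewrite sqr_l2norm; apply: le_trans (_ : l1norm u ^+ 2 <= _).
    under eq_bigr do rewrite -real_normK ?num_real//.
    exact: sum_sqr_le_sqr_sum.
  have -> : l1norm u = 0 by apply/le_anti; rewrite u0 l1norm_ge0.
  by rewrite expr0n.
have N0 : 0 < N%:R :> R by rewrite ltr0n.
have K0 : 0 <= K by lra.
have S2 : (0 < 2 * S)%N by rewrite muln_gt0.
have S2m : (2 * S <= m)%N.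
  rewrite -(ler_nat R) natrM; lra.
have kap0 : 0 < kappa by exact: fine_kappaX_gt0.
pose c := Num.sqrt N%:R * kappa.
have c_gt0 : 0 < c by rewrite mulr_gt0// sqrtr_gt0.
have cE : c ^+ 2 = N%:R * kappa ^+ 2 by rewrite exprMn sqr_sqrtr// ltW.
pose s : R := Num.sqrt S%:R.
have s_gt0 : 0 < s by rewrite sqrtr_gt0 ltr0n.
have sE : s ^+ 2 = S%:R by rewrite sqr_sqrtr.
have csigma : c <= sigmaX X S by apply: kappaX_le_sigmaX => //; exact: ltW.
have near_cone := near_cone_bound _ _ _ _ X _ _ _ _ S0 S2m s_gt0 sE c_gt0
  csigma K_gt1 (sigmaX_bound X S) (fun v J Js vJ => fine_kappaX_bound X
    (2 * S) K v J N_ge1 (ltW kappa_gt0) Js vJ).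
pose a j := l1norm (proj (spt (block theta j)) (block delta j)).
pose b j := l1norm (proj (~: spt (block theta j))%SET (block delta j)).
pose z j := l2norm (X *m block delta j) / c.
have L0 : 0 < L.
  by rewrite /L !(mulr_gt0, invr_gt0, exprn_gt0)//; lra.
rewrite -/delta sqr_l2norm_block -sE -cE.
have -> : 2 * (1 + K ^+ 2) * (c ^+ 2 + sigmaX X S ^+ 2 * k%:R) / c ^+ 2 =
    2 * (1 + K ^+ 2) * (1 + (sigmaX X S / c) ^+ 2 * k%:R).
  by field; rewrite gt_eqF.
apply: (@sum_excess_bound _ _ K L s _ a b z) => //.
- by move=> j; exact: l1norm_ge0.
- by move=> j; rewrite divr_ge0 ?l2norm_ge0// ltW.
- have H : Cgamma * \sum_(i < N) l2norm (Z i *m delta) ^+ 2 +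
      2 * Mq / (K - 1) * \sum_j (b j - K * a j) <= 0.
    rewrite -lerBrDr sub0r [X in - X]mulr_sumr -sumrN; apply: le_trans excess _.
    rewrite !l1norm_block mulr_sumr -sumrB mulr_sumr -big_split.
    apply: ler_sum => j _ /=.
    have := l1norm_sub_le_spt (block theta j) (block u j).
    rewrite -blockB -/delta -/(a j) -/(b j) => hj.
    rewrite (l1norm_split (spt (block theta j)) (block delta j)) -/(a j) -/(b j).
    have la : 0 <= lambda by lra.
    have := ler_wpM2l la hj.
    have -> : - (2 * Mq / (K - 1) * (b j - K * a j)) =
      (2 * Mq / (K - 1) * K) * a j - 2 * Mq / (K - 1) * b j by ring.
    by rewrite -lambdaE1 -lambdaE2; lra.
  rewrite sum_sqr_l2norm_blockdiag in H.
  (* [L / K] is [2 * Mq / (K - 1)] divided by [Cgamma * c ^+ 2]. *)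
  have -> : \sum_j z j ^+ 2 + L / K * \sum_j (b j - K * a j) =
    (Cgamma * c ^+ 2)^-1 * (Cgamma * \sum_(j < k) l2norm (X *m block delta j) ^+ 2 +
      2 * Mq / (K - 1) * \sum_j (b j - K * a j)).
    under eq_bigr do rewrite exprMn.
    rewrite -mulr_suml /L -cE; field.
    by rewrite !gt_eqF//; lra.
  by rewrite pmulr_rle0// invr_gt0 mulr_gt0 ?exprn_gt0.
- move=> j e e0 bj; apply: near_cone => //; exact: card_spt_block.
Qed.
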